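(* If $r\ge 2$ is an integer, then $$\int_0^{\pi/2}\frac{x^2}{L_r^2+4+4L_r\cos(2x)}\,dx = \frac{1}{L_r^2-4}\left(\frac{\pi^3}{24}+\frac{\pi}{2}\,\mathrm{Li}_2\left(\frac{2}{L_r}\right)\right).$$ In particular, $$\int_0^{\pi/2}\frac{x^2}{5+4\cos(2x)}\,dx = \frac{\pi^3}{36}-\frac{\pi}{12}\ln^2 2.$$
   Context: The Lucas numbers are $L_0=2$, $L_1=1$, $L_n=L_{n-1}+L_{n-2}$. The dilogarithm is $\mathrm{Li}_2(z)=\sum_{k=1}^\infty z^k/k^2$ for $|z|<1$. *)

(* Defs.v *)
From Stdlib Require Import Reals.
From Coquelicot Require Import Coquelicot.

Fixpoint lucas (n : nat) : nat :=
  match n with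
  | O => 2
  | S O => 1
  | S (S m as p) => lucas p + lucas m
  end%nat.

(* The sum over k >= 1 of z^k / k^2 is reindexed by k = S n, so that the
   series has no spurious 0-th term 1/0.  The definition is meaningful for
   |z| < 1 (and on the boundary), where the series converges; [Series] returns
   an unspecified value elsewhere. *)
Definition Li2 (z : R) : R :=
  Series (fun n : nat => (z ^ S n / INR (S n) ^ 2)%R).

(* Main.v *)
Require Import Defs.
From Stdlib Require Import Reals Lra Lia.
From Coquelicot Require Import Coquelicot.
Open Scope R_scope.

(** The integrand is a multiple of x^2 times the Poisson kernel
    (1 - b^2) / (1 - 2 b cos 2x + b^2) = 1 + 2 sum_(n >= 1) b^n cos 2nx with
    b = -2/L, and the integral of x^2 cos 2nx over [0, PI/2] is
    (-1)^n PI / (4 n^2), so integrating termwise gives Li2 (-b).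

    The second integral is the case L = L_3 = 4, up to a factor, and needs
    Li2 (1/2).  As b = s tends to 1 from below, the kernel integral tends to 0,
    because x^2 / (1 - 2 s cos 2x + s^2) <= x^2 / (4 s sin^2 x) stays bounded;
    hence Li2 (-s) tends to -PI^2/12.  Landen's identity
    Li2 (-s) + Li2 (s / (1 + s)) = - ln^2 (1 + s) / 2 turns this into the value
    of Li2 (1/2), without the Basel sum or Abel's theorem. *)

(** * Termwise integration of the Poisson kernel *)

Lemma sum_n_S (a : nat -> R) (n : nat) : sum_n a (S n) = sum_n a n + a (S n).
Proof. exact (sum_Sn a n). Qed.

(** Since [2 cos t cos kt = cos (k+1)t + cos (k-1)t], the product telescopes; the two boundary terms
    at the end are the truncation error, of order [b ^ N]. *)
Lemma poisson_partial_sum (b t : R) (N : nat) :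
  (1 - 2 * b * cos t + b ^ 2) *
    (1 + 2 * sum_n (fun k => b ^ S k * cos (INR (S k) * t)) N) =
  1 - b ^ 2 + 2 * b ^ (N + 3) * cos (INR (S N) * t)
    - 2 * b ^ (N + 2) * cos (INR (S (S N)) * t).
Proof.
induction N as [|N IH].
- rewrite sum_O; simpl.
  replace ((1 + 1) * t) with (2 * t) by ring.
  rewrite cos_2a_cos, Rmult_1_l; ring.
- rewrite sum_n_S.
  set (S0 := sum_n _ N) in *.
  assert (Hc : cos (INR (S (S (S N))) * t) =
    2 * cos t * cos (INR (S (S N)) * t) - cos (INR (S N) * t)).
  { replace (INR (S (S (S N))) * t) with (INR (S (S N)) * t + t)
      by (rewrite !S_INR; ring).
    replace (INR (S N) * t) with (INR (S (S N)) * t - t)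
      by (rewrite !S_INR; ring).
    rewrite cos_plus, cos_minus; ring. }
  rewrite Hc.
  transitivity ((1 - 2 * b * cos t + b ^ 2) * (1 + 2 * S0) +
    (1 - 2 * b * cos t + b ^ 2) * 2 * (b ^ S (S N) * cos (INR (S (S N)) * t))).
  { ring. }
  rewrite IH.
  replace (S N + 3)%nat with (4 + N)%nat by lia.
  replace (S N + 2)%nat with (3 + N)%nat by lia.
  replace (N + 3)%nat with (3 + N)%nat by lia.
  replace (N + 2)%nat with (2 + N)%nat by lia.
  cbn -[INR cos]; ring.
Qed.

(** The right side is the squared modulus of [1 - b e^(it)], and the reverse triangle inequality
    applies. *)
Lemma poisson_denominator_ge (b t : R) :
  (1 - Rabs b) ^ 2 <= 1 - 2 * b * cos t + b ^ 2.
Proof.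
assert (H : b * cos t <= Rabs b).
{ apply Rle_trans with (1 := Rle_abs _).
  rewrite Rabs_mult.
  assert (Hc := COS_bound t).
  assert (Rabs (cos t) <= 1) by (apply Rabs_le; lra).
  assert (Hb := Rabs_pos b); nra. }
assert (Hq := pow2_abs b); nra.
Qed.

Lemma is_RInt_sqr : is_RInt (fun x => x ^ 2) 0 (PI / 2) (PI ^ 3 / 24).
Proof.
replace (PI ^ 3 / 24) with (minus ((PI / 2) ^ 3 / 3) (0 ^ 3 / 3))
  by (unfold minus, plus, opp; simpl; field).
apply (is_RInt_derive (fun x : R => x ^ 3 / 3)).
- intros x _; auto_derive; [trivial | field].
- intros x _; apply (ex_derive_continuous (fun x : R => x ^ 2)); auto_derive; trivial.
Qed.

Lemma is_RInt_sqr_cos (n : nat) :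
  is_RInt (fun x => x ^ 2 * cos (INR (S n) * (2 * x))) 0 (PI / 2)
    (PI / 4 * ((-1) ^ S n / INR (S n) ^ 2)).
Proof.
assert (Hn : INR (S n) <> 0) by (apply not_0_INR; lia).
set (m := INR (S n)) in *.
(* Antiderivative from integrating by parts twice. At [PI / 2] only its cosine term survives, and at
   [0] every term vanishes. *)
set (F := fun x : R => x ^ 2 * sin (m * (2 * x)) / (2 * m)
   + 2 * x * cos (m * (2 * x)) / (4 * m ^ 2) - 2 * sin (m * (2 * x)) / (8 * m ^ 3)).
assert (Hs : sin (m * PI) = 0).
{ apply sin_eq_0_1; exists (Z.of_nat (S n)); now rewrite <- INR_IZR_INZ. }
assert (Hc : forall k, cos (INR k * PI) = (-1) ^ k).
{ induction k as [|k IH]; [simpl; rewrite Rmult_0_l; apply cos_0|].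
  rewrite S_INR, Rmult_plus_distr_r, Rmult_1_l, neg_cos, IH; simpl; ring. }
replace (PI / 4 * ((-1) ^ S n / m ^ 2)) with (minus (F (PI / 2)) (F 0)).
2: { change (F (PI / 2) - F 0 = PI / 4 * ((-1) ^ S n / m ^ 2)); unfold F.
  replace (m * (2 * (PI / 2))) with (m * PI) by field.
  rewrite Hs; unfold m; rewrite Hc; fold m.
  rewrite !Rmult_0_r, sin_0; field; exact Hn. }
apply (is_RInt_derive F).
- intros x _; unfold F; auto_derive; [trivial | field; exact Hn].
- intros x _; apply (ex_derive_continuous (fun x : R => x ^ 2 * cos (m * (2 * x)))).
  auto_derive; trivial.
Qed.

Lemma is_RInt_sqr_partial_sum (b : R) (N : nat) :
  is_RInt (fun x => x ^ 2 *
      (1 + 2 * sum_n (fun k => b ^ S k * cos (INR (S k) * (2 * x))) N))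
    0 (PI / 2)
    (PI ^ 3 / 24 + PI / 2 * sum_n (fun k => (- b) ^ S k / INR (S k) ^ 2) N).
Proof.
assert (Hk : forall k, is_RInt
  (fun x => 2 * b ^ S k * (x ^ 2 * cos (INR (S k) * (2 * x)))) 0 (PI / 2)
  (PI / 2 * ((- b) ^ S k / INR (S k) ^ 2))).
{ intro k.
  replace (PI / 2 * ((- b) ^ S k / INR (S k) ^ 2))
    with (scal (2 * b ^ S k) (PI / 4 * ((-1) ^ S k / INR (S k) ^ 2))).
  - apply (is_RInt_scal (fun x : R => x ^ 2 * cos (INR (S k) * (2 * x)))), is_RInt_sqr_cos.
  - replace (- b) with (-1 * b) by ring.
    rewrite Rpow_mult_distr; unfold scal; cbn -[INR pow]; unfold mult; cbn -[INR pow].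
    field; apply not_0_INR; lia. }
induction N as [|N IH].
- rewrite sum_O.
  eapply is_RInt_ext; [|exact (is_RInt_plus _ _ _ _ _ _ is_RInt_sqr (Hk 0%nat))].
  intros x _; rewrite sum_O; unfold plus; cbn -[INR pow]; ring.
- rewrite sum_n_S, Rmult_plus_distr_l, <- Rplus_assoc.
  eapply is_RInt_ext; [|exact (is_RInt_plus _ _ _ _ _ _ IH (Hk (S N)))].
  intros x _; rewrite sum_n_S; unfold plus; cbn -[INR pow sum_n]; ring.
Qed.

(** The truncation error divided by the denominator is at most [4 |b|^N / (1 - |b|)^2] uniformly in
    [x], so the integrals of the partial sums converge geometrically. *)
Theorem is_RInt_sqr_poisson (b : R) : Rabs b < 1 ->
  is_RInt (fun x => x ^ 2 * ((1 - b ^ 2) / (1 - 2 * b * cos (2 * x) + b ^ 2)))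
    0 (PI / 2) (PI ^ 3 / 24 + PI / 2 * Li2 (- b)).
Proof.
intros Hb.
assert (Hpi := PI_RGT_0).
set (g := fun x : R => x ^ 2 * ((1 - b ^ 2) / (1 - 2 * b * cos (2 * x) + b ^ 2))).
assert (Hd : 0 < (1 - Rabs b) ^ 2) by (apply pow_lt; lra).
assert (Hden : forall t, 0 < 1 - 2 * b * cos t + b ^ 2).
{ intro t; assert (H := poisson_denominator_ge b t); lra. }
assert (Hg : exists I : R, is_RInt g 0 (PI / 2) I).
{ apply (@ex_RInt_continuous R_CompleteNormedModule); intros x _.
  apply (ex_derive_continuous g); unfold g; auto_derive.
  assert (H := Hden (2 * x)); simpl in *; lra. }
destruct Hg as [I Hg].
set (u := sum_n (fun k => (- b) ^ S k / INR (S k) ^ 2)).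
(* Length of the interval, times the maximum of [x ^ 2], times the bound on the kernel error. *)
set (C := (PI / 2) * ((PI / 2) ^ 2 * (4 / (1 - Rabs b) ^ 2))).
assert (Hclose : forall N,
  Rabs (PI ^ 3 / 24 + PI / 2 * u N - I) <= C * Rabs b ^ N).
{ intro N.
  assert (HI := is_RInt_minus _ _ _ _ _ _ (is_RInt_sqr_partial_sum b N) Hg).
  replace (C * Rabs b ^ N) with
    ((PI / 2 - 0) * ((PI / 2) ^ 2 * (4 / (1 - Rabs b) ^ 2 * Rabs b ^ N)))
    by (unfold C; ring).
  refine (norm_RInt_le_const _ 0 (PI / 2) _ _ _ _ HI); [lra|].
  intros x Hx.
  assert (HP := poisson_partial_sum b (2 * x) N).
  assert (H1 := Hden (2 * x)).
  assert (H2 := poisson_denominator_ge b (2 * x)).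
  unfold g; cbn -[INR pow sum_n]; unfold minus, plus, opp; cbn -[INR pow sum_n].
  set (D := 1 - 2 * b * cos (2 * x) + b ^ 2) in *.
  set (Q := 1 + 2 * sum_n _ N) in *.
  set (E := 2 * b ^ (N + 3) * cos (INR (S N) * (2 * x))
    - 2 * b ^ (N + 2) * cos (INR (S (S N)) * (2 * x))).
  assert (HE : Rabs E <= 4 * Rabs b ^ N).
  { assert (Hc : forall k t, Rabs (2 * b ^ (N + k) * cos t) <= 2 * Rabs b ^ N).
    { intros k t.
      rewrite !Rabs_mult, <- RPow_abs, (Rabs_pos_eq 2), pow_add by lra.
      assert (0 <= Rabs b ^ N) by apply pow_le, Rabs_pos.
      assert (Rabs (cos t) <= 1) by (apply Rabs_le; exact (COS_bound t)).
      assert (0 <= Rabs b ^ k <= 1).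
      { split; [apply pow_le, Rabs_pos|].
        rewrite <- (pow1 k); apply pow_incr; split; [apply Rabs_pos|lra]. }
      assert (Rabs b ^ k * Rabs (cos t) <= 1)
        by (assert (Hp := Rabs_pos (cos t)); nra).
      nra. }
    unfold E, Rminus.
    eapply Rle_trans; [apply Rabs_triang|].
    rewrite Rabs_Ropp.
    assert (A1 := Hc 3%nat (INR (S N) * (2 * x))).
    assert (A2 := Hc 2%nat (INR (S (S N)) * (2 * x))).
    lra. }
  assert (Heq : x ^ 2 * Q + - (x ^ 2 * ((1 - b ^ 2) / D)) = x ^ 2 * (E / D)).
  { replace E with (D * Q - (1 - b ^ 2)) by (unfold E; rewrite HP; ring).
    field; lra. }
  change (Rabs (x ^ 2 * Q + - (x ^ 2 * ((1 - b ^ 2) / D))) <=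
    (PI / 2) ^ 2 * (4 / (1 - Rabs b) ^ 2 * Rabs b ^ N)).
  rewrite Heq, Rabs_mult.
  apply Rmult_le_compat; try apply Rabs_pos.
  - rewrite Rabs_pos_eq by apply pow2_ge_0; apply pow_incr; lra.
  - unfold Rdiv; rewrite Rabs_mult, (Rabs_pos_eq (/ D))
      by (left; apply Rinv_0_lt_compat; exact H1).
    replace (4 * / (1 - Rabs b) ^ 2 * Rabs b ^ N)
      with (4 * Rabs b ^ N * / (1 - Rabs b) ^ 2) by ring.
    apply Rmult_le_compat; [apply Rabs_pos| |exact HE|].
    + left; apply Rinv_0_lt_compat; exact H1.
    + apply Rinv_le_contravar; assumption. }
assert (Hgeom : is_lim_seq (fun N => C * Rabs b ^ N) 0).
{ replace (Finite 0) with (Rbar_mult C 0) by (simpl; f_equal; ring).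
  apply is_lim_seq_scal_l, is_lim_seq_geom; rewrite Rabs_Rabsolu; exact Hb. }
assert (Hlim0 : is_lim_seq
   (fun N => PI ^ 3 / 24 + PI / 2 * u N - I) 0).
{ apply is_lim_seq_abs_0.
  apply (is_lim_seq_le_le (fun _ => 0) _ (fun N => C * Rabs b ^ N));
    [|apply is_lim_seq_const|exact Hgeom].
  intro N; split; [apply Rabs_pos|apply Hclose]. }
(* As [u] is the sequence of partial sums of [Li2 (- b)], solving the limit relation for [u] gives
   the sum of the series in terms of [I]. *)
assert (Hu : is_lim_seq u (2 / PI * (I - PI ^ 3 / 24))).
{ apply (is_lim_seq_ext (fun N => 2 / PI *
    ((PI ^ 3 / 24 + PI / 2 * u N - I) +
     (I - PI ^ 3 / 24)))).
  { intro N; field; lra. }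
  apply (is_lim_seq_scal_l _ (2 / PI) (I - PI ^ 3 / 24)).
  replace (Finite (I - PI ^ 3 / 24)) with
    (Finite (0 + (I - PI ^ 3 / 24))) by (f_equal; ring).
  apply is_lim_seq_plus'; [exact Hlim0|apply is_lim_seq_const]. }
replace (PI ^ 3 / 24 + PI / 2 * Li2 (- b)) with (I); [exact Hg|].
unfold Li2; rewrite (is_series_unique _ _ Hu); field; lra.
Qed.

(** * The dilogarithm as a power series, and Landen's identity *)

Lemma CV_radius_ge_1 (a : nat -> R) :
  (forall n, Rabs (a n) <= 1) -> Rbar_le 1 (CV_radius a).
Proof.
intros Ha; apply (CV_radius_bounded a); exists 1; intro n.
rewrite pow1, Rmult_1_r; apply Ha.
Qed.

Lemma Rabs_inv_pow_INR_le_1 (n k : nat) : Rabs (/ INR (S n) ^ k) <= 1.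
Proof.
assert (H : 1 <= INR (S n)) by (rewrite S_INR; assert (Hn := pos_INR n); lra).
assert (H1 : 1 <= INR (S n) ^ k) by now apply pow_R1_Rle.
rewrite Rabs_pos_eq by (left; apply Rinv_0_lt_compat; lra).
rewrite <- Rinv_1; apply Rinv_le_contravar; lra.
Qed.

(** A general exponent serves both [Li2] ([k = 1]) and the logarithm series ([k = 0], with geometric
    derivative). *)
Lemma is_derive_PSeries_incr_1 (k : nat) (z : R) : Rabs z < 1 ->
  is_derive (PSeries (PS_incr_1 (fun n => / INR (S n) ^ S k))) z
    (PSeries (fun n => / INR (S n) ^ k) z).
Proof.
intros Hz.
rewrite (PSeries_ext _ (PS_derive (PS_incr_1 (fun n => / INR (S n) ^ S k)))).
- apply is_derive_PSeries, (Rbar_lt_le_trans _ 1); [exact Hz|].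
  rewrite CV_radius_incr_1; apply CV_radius_ge_1; intro n.
  apply Rabs_inv_pow_INR_le_1.
- intro n; unfold PS_derive, PS_incr_1; cbn -[INR].
  assert (INR (S n) <> 0) by (apply not_0_INR; lia).
  field; split; [apply pow_nonzero|]; assumption.
Qed.

Lemma Li2_PSeries (z : R) :
  Li2 z = PSeries (PS_incr_1 (fun n => / INR (S n) ^ 2)) z.
Proof.
rewrite PSeries_incr_1; unfold Li2, PSeries; rewrite <- Series_scal_l.
apply Series_ext; intro n; unfold Rdiv; cbn -[INR]; ring.
Qed.

(** This is [- ln (1 - z) / z], extended by its limit 1 at [z = 0]. *)
Definition log_quotient (z : R) : R := PSeries (fun n => / INR (S n) ^ 1) z.

Lemma is_derive_Li2 (z : R) : Rabs z < 1 -> is_derive Li2 z (log_quotient z).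
Proof.
intros Hz.
apply (is_derive_ext (PSeries (PS_incr_1 (fun n => / INR (S n) ^ 2)))).
- intro t; symmetry; apply Li2_PSeries.
- now apply is_derive_PSeries_incr_1.
Qed.

Lemma log_quotientE (z : R) : Rabs z < 1 -> z * log_quotient z = - ln (1 - z).
Proof.
intros Hz; apply Rabs_def2 in Hz.
(* The derivative of [h] is the geometric series minus [1 / (1 - t)], so [h] is constant and equal
   to [h 0 = 0]. *)
set (h := fun z : R => PSeries (PS_incr_1 (fun n => / INR (S n) ^ 1)) z + ln (1 - z)).
assert (Hh : forall t, -1 < t < 1 -> is_derive h t 0).
{ intros t Ht.
  replace 0 with (PSeries (fun n => / INR (S n) ^ 0) t + - / (1 - t)).
  - apply (is_derive_plus (PSeries _) (fun z : R => ln (1 - z))).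
    + apply (is_derive_PSeries_incr_1 0), Rabs_def1; lra.
    + auto_derive; [lra|field; lra].
  - unfold PSeries; rewrite (Series_ext _ (fun n => t ^ n)).
    + rewrite Series_geom by (apply Rabs_def1; lra); ring.
    + intro n; simpl; field. }
assert (H0 : h 0 = 0).
{ unfold h; rewrite PSeries_incr_1, Rminus_0_r, ln_1; ring. }
assert (Hz0 : h z = 0).
{ destruct (Rtotal_order z 0) as [Hlt|[->|Hgt]].
  - rewrite <- H0; apply eq_is_derive; [|lra]; intros t Ht; apply Hh; lra.
  - exact H0.
  - rewrite <- H0; symmetry; apply eq_is_derive; [|lra]; intros t Ht; apply Hh; lra. }
unfold h in Hz0; rewrite PSeries_incr_1 in Hz0; unfold log_quotient; lra.
Qed.

Lemma Li2_landen (s : R) : 0 < s < 1 ->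
  Li2 (- s) + Li2 (s / (1 + s)) = - ln (1 + s) ^ 2 / 2.
Proof.
intros Hs.
(* [G] vanishes at 0, and its derivative is zero: by the chain rule it is a combination of log
   quotients in which both logarithms reduce to [ln (1 + t)]. *)
set (G := fun s : R => Li2 (- s) + Li2 (s / (1 + s)) + ln (1 + s) ^ 2 / 2).
assert (Hq : forall t, 0 <= t < 1 -> Rabs (t / (1 + t)) < 1).
{ intros t Ht.
  assert (t / (1 + t) < 1) by (apply Rlt_div_l; lra).
  assert (0 <= t / (1 + t)) by (apply Rdiv_le_0_compat; lra).
  apply Rabs_def1; lra. }
assert (HG : forall t, 0 <= t <= s -> is_derive G t 0).
{ intros t Ht.
  assert (Hm : Rabs (- t) < 1) by (apply Rabs_def1; lra).
  assert (Hqt := Hq t ltac:(lra)).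
  assert (E1 := log_quotientE _ Hm); assert (E2 := log_quotientE _ Hqt).
  replace (1 - - t) with (1 + t) in E1 by ring.
  replace (1 - t / (1 + t)) with (/ (1 + t)) in E2 by (field; lra).
  rewrite ln_Rinv in E2 by lra.
  set (A := log_quotient (- t)) in *; set (B := log_quotient (t / (1 + t))) in *.
  replace 0 with (- 1 * A + / (1 + t) ^ 2 * B + ln (1 + t) / (1 + t)).
  - apply (is_derive_plus (fun s : R => Li2 (- s) + Li2 (s / (1 + s)))
      (fun s : R => ln (1 + s) ^ 2 / 2)).
    + apply (is_derive_plus (fun s : R => Li2 (- s)) (fun s : R => Li2 (s / (1 + s)))).
      * apply (is_derive_comp Li2 (fun s : R => - s));
          [now apply is_derive_Li2|auto_derive; [trivial|ring]].
      * apply (is_derive_comp Li2 (fun s : R => s / (1 + s)));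
          [now apply is_derive_Li2|auto_derive; [lra|field; lra]].
    + auto_derive; [lra|field; lra].
  (* At [t = 0] the quotients cannot be found by division, but both arguments are 0, so [A] and [B]
     cancel. *)
  - destruct (Req_dec t 0) as [Ht0|Ht0].
    + assert (HAB : A = B).
      { unfold A, B; f_equal; rewrite Ht0; field. }
      rewrite HAB, Ht0, Rplus_0_r, ln_1; field.
    + replace A with (ln (1 + t) / t).
      2: { apply (Rmult_eq_reg_l (- t)); [|lra]; rewrite E1; field; exact Ht0. }
      replace B with (ln (1 + t) * (1 + t) / t).
      2: { apply (Rmult_eq_reg_l (t / (1 + t))).
        - rewrite E2; field; lra.
        - unfold Rdiv; apply Rmult_integral_contrapositive_currified;
            [exact Ht0|apply Rinv_neq_0_compat; lra]. }
      field; lra. }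
assert (H : G 0 = G s) by (apply eq_is_derive; [exact HG|lra]).
assert (H0 : Li2 0 = 0) by (rewrite Li2_PSeries, PSeries_incr_1; ring).
unfold G in H.
rewrite Ropp_0, Rplus_0_r, ln_1, Rdiv_0_l, H0 in H; lra.
Qed.

(** * The limit as s tends to 1, and the value of Li2 (1/2) *)

Lemma sin_ge_third (x : R) : 0 <= x <= PI / 2 -> x / 3 <= sin x.
Proof.
intros Hx.
assert (Hpi := PI_4).
destruct (sin_bound x 0) as [H _]; [lra|lra|].
apply Rle_trans with (2 := H).
unfold sin_approx, sin_term; simpl.
(* With [PI <= 4] one has [x <= 2], hence [1 - x ^ 2 / 6 >= 1 / 3]. *)
apply Rle_trans with (x - x ^ 3 / 6); [|right; field].
assert (x ^ 2 <= 4) by (simpl; nra); nra.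
Qed.

Lemma Li2_opp_bound (s : R) : 0 < s < 1 ->
  0 <= PI ^ 3 / 24 + PI / 2 * Li2 (- s) <= 9 * PI / (8 * s) * (1 - s ^ 2).
Proof.
intros Hs.
assert (Hpi := PI_RGT_0).
assert (Habs : Rabs s < 1) by (apply Rabs_def1; lra).
assert (HI := is_RInt_sqr_poisson s Habs).
assert (Hden : forall x, 1 - 2 * s * cos (2 * x) + s ^ 2 = (1 - s) ^ 2 + 4 * s * (sin x) ^ 2).
{ intro x; rewrite cos_2a_sin; ring. }
assert (Hd : forall x, 0 < 1 - 2 * s * cos (2 * x) + s ^ 2).
{ intro x; rewrite Hden; assert (0 < (1 - s) ^ 2) by (apply pow_lt; lra).
  assert (Hsq := pow2_ge_0 (sin x)); nra. }
split.
- apply (is_RInt_le (fun _ => 0) _ 0 (PI / 2) _ _ ltac:(lra)) with (2 := HI).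
  + replace 0 with (scal (PI / 2 - 0) 0) at 2 by (unfold scal; simpl; apply Rmult_0_r).
    apply (@is_RInt_const R_NormedModule).
  + intros x _; apply Rmult_le_pos; [apply pow2_ge_0|].
    apply Rdiv_le_0_compat; [nra|apply Hd].
(* The denominator is at least [4 s sin^2 x], and [x ^ 2 <= 9 sin^2 x], so the integrand lies below
   a constant. *)
- apply (is_RInt_le _ (fun _ => 9 / (4 * s) * (1 - s ^ 2)) 0 (PI / 2) _ _ ltac:(lra) HI).
  + replace (9 * PI / (8 * s) * (1 - s ^ 2))
      with (scal (PI / 2 - 0) (9 / (4 * s) * (1 - s ^ 2)))
      by (unfold scal; simpl; unfold mult; simpl; field; lra).
    apply (@is_RInt_const R_NormedModule).
  + intros x Hx.
    assert (Hsin := sin_ge_third x ltac:(lra)).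
    assert (Hdx := Hd x).
    replace (x ^ 2 * ((1 - s ^ 2) / (1 - 2 * s * cos (2 * x) + s ^ 2)))
      with (x ^ 2 / (1 - 2 * s * cos (2 * x) + s ^ 2) * (1 - s ^ 2)) by (field; lra).
    apply Rmult_le_compat_r; [nra|].
    apply Rle_div_l; [exact Hdx|].
    rewrite Hden.
    assert (Hx2 : x ^ 2 <= 9 * sin x ^ 2) by nra.
    replace (9 / (4 * s) * ((1 - s) ^ 2 + 4 * s * sin x ^ 2))
      with (9 / (4 * s) * (1 - s) ^ 2 + 9 * sin x ^ 2) by (field; lra).
    assert (0 <= 9 / (4 * s) * (1 - s) ^ 2).
    { apply Rmult_le_pos; [apply Rdiv_le_0_compat; lra|apply pow2_ge_0]. }
    lra.
Qed.

Lemma Li2_half : Li2 (1 / 2) = PI ^ 2 / 12 - ln 2 ^ 2 / 2.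
Proof.
assert (Hpi := PI_RGT_0).
(* Landen's identity replaces [Li2 (- s)], whose argument tends to the boundary point -1, by
   [Li2 (s / (1 + s))], whose argument tends to 1/2. This makes [F] continuous at 1, where the bound
   [U] vanishes. *)
set (F := fun s : R => PI ^ 3 / 24 + PI / 2 * (- ln (1 + s) ^ 2 / 2 - Li2 (s / (1 + s)))).
set (U := fun s : R => 9 * PI / (8 * s) * (1 - s ^ 2)).
assert (HF : forall s, 0 < s < 1 -> 0 <= F s <= U s).
{ intros s Hs; unfold F; rewrite <- (Li2_landen s Hs).
  replace (Li2 (- s) + Li2 (s / (1 + s)) - Li2 (s / (1 + s))) with (Li2 (- s)) by ring.
  now apply Li2_opp_bound. }
assert (CF : continuous F 1).
{ apply (ex_derive_continuous F).
  assert (ex_derive Li2 (1 / (1 + 1))).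
  { eexists; apply is_derive_Li2, Rabs_def1; lra. }
  unfold F; auto_derive; repeat split; try assumption; lra. }
assert (CU : continuous U 1).
{ apply (ex_derive_continuous U); unfold U; auto_derive; lra. }
(* The shift by 2 keeps every term strictly between 0 and 1. *)
assert (Hs : is_lim_seq (fun n => 1 - / INR (n + 2)) 1).
{ replace (Finite 1) with (Finite (1 - 0)) by (f_equal; ring).
  apply is_lim_seq_minus'; [apply is_lim_seq_const|].
  apply (is_lim_seq_incr_n (fun n => / INR n) 2).
  change (Finite 0) with (Rbar_inv p_infty).
  apply is_lim_seq_inv; [apply is_lim_seq_INR|discriminate]. }
assert (Hr : forall n, 0 < 1 - / INR (n + 2) < 1).
{ intro n; rewrite plus_INR; simpl INR.
  assert (Hn := pos_INR n).
  assert (0 < / (INR n + (1 + 1))) by (apply Rinv_0_lt_compat; lra).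
  assert (/ (INR n + (1 + 1)) <= / 2) by (apply Rinv_le_contravar; lra).
  lra. }
assert (LF := is_lim_seq_continuous F _ 1 ltac:(now apply continuity_pt_filterlim) Hs).
assert (LU := is_lim_seq_continuous U _ 1 ltac:(now apply continuity_pt_filterlim) Hs).
assert (L0 := is_lim_seq_le_le _ _ _ _ (fun n => HF _ (Hr n)) (is_lim_seq_const 0)).
replace (U 1) with 0 in LU by (unfold U; field).
specialize (L0 LU).
assert (H : F 1 = 0).
{ apply is_lim_seq_unique in LF; apply is_lim_seq_unique in L0; congruence. }
unfold F in H.
replace (1 / (1 + 1)) with (1 / 2) in H by field.
replace (1 + 1) with 2 in H by ring.
apply (Rmult_eq_reg_l (PI / 2)); [|lra].
replace (PI / 2 * (PI ^ 2 / 12 - ln 2 ^ 2 / 2))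
  with (PI ^ 3 / 24 + PI / 2 * (- ln 2 ^ 2 / 2)) by field.
lra.
Qed.

(** * Specialisation to Lucas numbers and to L = 4 *)

Lemma lucas_ge_3 (r : nat) : (2 <= r)%nat -> (3 <= lucas r)%nat.
Proof.
intros Hr.
assert (Hpos : forall n, (1 <= lucas n)%nat /\ (1 <= lucas (S n))%nat).
{ induction n as [|n [IH1 IH2]]; [simpl; lia|].
  split; [exact IH2|change (lucas (S (S n))) with (lucas (S n) + lucas n)%nat; lia]. }
(* Induction on consecutive pairs, starting from [L_2 = 3] and [L_3 = 4]; the resulting [L_r > 2]
   puts [2 / L_r] inside the unit disc. *)
assert (H : forall n, (3 <= lucas (S (S n)))%nat /\ (3 <= lucas (S (S (S n))))%nat).
{ induction n as [|n [IH1 IH2]]; [simpl; lia|].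
  split; [exact IH2|].
  change (lucas (S (S (S (S n))))) with (lucas (S (S (S n))) + lucas (S (S n)))%nat; lia. }
destruct r as [|[|r]]; [lia|lia|apply H].
Qed.

(** Take [b = - 2 / L] in the Poisson integral and multiply numerator and denominator of the kernel
    by [L ^ 2]: they become [L ^ 2 - 4] and [L ^ 2 + 4 + 4 L cos 2x]. *)
Lemma is_RInt_sqr_over (L : R) : 2 < L ->
  is_RInt (fun x => x ^ 2 / (L ^ 2 + 4 + 4 * L * cos (2 * x))) 0 (PI / 2)
    (1 / (L ^ 2 - 4) * (PI ^ 3 / 24 + PI / 2 * Li2 (2 / L))).
Proof.
intros HL.
assert (Hb : Rabs (- (2 / L)) < 1).
{ rewrite Rabs_Ropp, Rabs_pos_eq by (apply Rdiv_le_0_compat; lra).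
  apply Rlt_div_l; lra. }
assert (HI := is_RInt_sqr_poisson _ Hb).
rewrite Ropp_involutive in HI.
eapply is_RInt_ext; [|exact (is_RInt_scal _ 0 (PI / 2) (1 / (L ^ 2 - 4)) _ HI)].
intros x _; unfold scal; cbn -[pow]; unfold mult; cbn -[pow].
assert (Hc := COS_bound (2 * x)).
field; repeat split; nra.
Qed.

Theorem theorem30 :
  (forall r : nat, (2 <= r)%nat ->
     is_RInt
       (fun x : R =>
          x ^ 2 / (INR (lucas r) ^ 2 + 4 + 4 * INR (lucas r) * cos (2 * x)))
       0 (PI / 2)
       (1 / (INR (lucas r) ^ 2 - 4) *
          (PI ^ 3 / 24 + PI / 2 * Li2 (2 / INR (lucas r)))))
  /\
  is_RInt (fun x : R => x ^ 2 / (5 + 4 * cos (2 * x)))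
    0 (PI / 2)
    (PI ^ 3 / 36 - PI / 12 * (ln 2) ^ 2).
Proof.
split.
- intros r Hr; apply is_RInt_sqr_over.
  assert (H := le_INR _ _ (lucas_ge_3 r Hr)); simpl in H; lra.
(* For [L = 4] the denominator is [20 + 16 cos 2x = 4 (5 + 4 cos 2x)], hence the factor 4. *)
- assert (HI := is_RInt_scal _ 0 (PI / 2) 4 _ (is_RInt_sqr_over 4 ltac:(lra))).
  replace (2 / 4) with (1 / 2) in HI by field.
  rewrite Li2_half in HI.
  replace (PI ^ 3 / 36 - PI / 12 * ln 2 ^ 2) with
    (scal 4 (1 / (4 ^ 2 - 4) *
      (PI ^ 3 / 24 + PI / 2 * (PI ^ 2 / 12 - ln 2 ^ 2 / 2))))
    by (unfold scal; cbn -[pow]; unfold mult; cbn -[pow]; field).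
  eapply is_RInt_ext; [|exact HI].
  intros x _; unfold scal; cbn -[pow]; unfold mult; cbn -[pow].
  assert (Hc := COS_bound (2 * x)).
  field; split; lra.
Qed.
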